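(* Let $f:[0,1]\to\mathbb{R}$ be a differentiable function whose derivative $f':[0,1]\to\mathbb{R}$ is an absolutely continuous function such that $f''\in L_1(0,1)$ and there exist real numbers $\gamma_2,\Gamma_2$ such that $\gamma_2\le f''(t)\le\Gamma_2$ for $t\in[0,1]$. Let $S_1=f'(1)-f'(0)$. Then $$|Q(f;0,1)-P(f;0,1)|\le\frac{\Gamma_2-\gamma_2}{2}\left(\frac{5}{96}\sqrt6-\frac{29}{432}\sqrt3\right),$$ $$|Q(f;0,1)-P(f;0,1)|\le\left(\frac1{12}-\frac{\sqrt2}{32}\right)(S_1-\gamma_2),$$ $$|Q(f;0,1)-P(f;0,1)|\le\left(\frac1{12}-\frac{\sqrt2}{32}\right)(\Gamma_2-S_1).$$
   Context: For $f$ on $[0,1]$, $$Q(f;0,1)=\int_0^1 f(t)\,dt-\left[\frac{\sqrt2}{8}f(0)+\left(1-\frac{\sqrt2}{4}\right)f\left(\tfrac12\right)+\frac{\sqrt2}{8}f(1)\right],$$ $$P(f;0,1)=\frac{1}{96}\left(4-3\sqrt2\right)\left[f'(1)-f'(0)\right].$$ The derivative $f''$ of the absolutely continuous function $f'$ exists almost everywhere, and the bounds $\gamma_2\le f''(t)\le\Gamma_2$ are understood for almost every $t$. *)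

(* Defs.v *)
From mathcomp Require Import all_boot all_order all_algebra.
From mathcomp Require Import all_classical all_reals all_analysis.

Set Implicit Arguments.
Unset Strict Implicit.
Unset Printing Implicit Defensive.

Import Order.TTheory GRing.Theory Num.Theory.
Import numFieldNormedType.Exports.

Local Open Scope classical_set_scope.
Local Open Scope ring_scope.

(* A function on an interval A is represented by a total function R -> R whose
   values outside A are irrelevant, so derivatives are taken along A: they are
   one-sided at the endpoints of A and the usual ones in its interior. *)
Definition derivable_on (R : realType) (A : set R) (f : R -> R) (x : R) : Prop :=
  cvg ((f y - f x) / (y - x) @[y --> within A x^']).

(* Unspecified where [derivable_on A f x] fails. *)
Definition derive_on (R : realType) (A : set R) (f : R -> R) (x : R) : R :=
  lim ((f y - f x) / (y - x) @[y --> within A x^']).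

Definition abs_cont_on (R : realType) (a b : R) (g : R -> R) : Prop :=
  forall e : R, 0 < e -> exists2 d : R, 0 < d &
    forall (n : nat) (u v : 'I_n -> R),
      (forall i, [/\ a <= u i, u i <= v i & v i <= b]) ->
      trivIset setT (fun i => [set` `]u i, v i[]) ->
      \sum_(i < n) (v i - u i) < d ->
      \sum_(i < n) `|g (v i) - g (u i)| < e.

Definition unit_itv (R : realType) : set R := `[0, 1].
Arguments unit_itv {R}.

Definition Q01 (R : realType) (f : R -> R) : R :=
  (\int[lebesgue_measure]_(t in unit_itv) f t)
  - (Num.sqrt 2 / 8 * f 0
     + (1 - Num.sqrt 2 / 4) * f (1 / 2)
     + Num.sqrt 2 / 8 * f 1).

Definition P01 (R : realType) (f : R -> R) : R :=
  1 / 96 * (4 - 3 * Num.sqrt 2)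
  * (derive_on unit_itv f 1 - derive_on unit_itv f 0).

(* Main.v *)
From HB Require Import structures.
Require Import Defs.
From mathcomp Require Import all_boot all_order all_algebra.
From mathcomp Require Import all_classical all_reals all_analysis.
From mathcomp Require Import measurable_realfun ring lra.

Import Order.TTheory GRing.Theory Num.Theory.
Import numFieldNormedType.Exports.

Local Open Scope classical_set_scope.
Local Open Scope ring_scope.

(** Integrating by parts twice, the error [Q01 f - P01 f] becomes the integral of
    [K f''] over [0, 1], where [K] is symmetric about 1/2 and, on [0, 1/2], is the
    quadratic [kernel], t^2/2 - sqrt 2/8 t + (3 sqrt 2 - 4)/96.  The correction
    [P01] is chosen exactly so that [K] has mean zero.  Hence constants may be
    subtracted from [f'']: the midpoint of [gamma2, Gamma2] gives the first bound,
    with the L^1 norm of [K], and each endpoint gives one of the other two, with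
    the maximum of [|K|], which is the value 1/12 - sqrt 2/32 of [K] at 1/2.

    To turn this into a proof one needs that [f'] moves at rates between [gamma2] and
    [Gamma2] on every subinterval ([derivative_bounds_of_ac]).  The
    bounds on [f''] are only almost everywhere, and [f''] is an unspecified value
    where [f'] is not differentiable, so differentiability almost everywhere has to
    be proved as well.  Write [f'] as a difference of two nondecreasing functions,
    its variation function [V] and [V - f'].  The total variation of an absolutely
    continuous function is absolutely continuous ([ac_seq_variation_fun]), so the
    two Lebesgue-Stieltjes measures are dominated by the Lebesgue measure
    ([lebesgue_stieltjes_dominated]).  Their Radon-Nikodym densities represent [f']
    as an indefinite integral ([ac_density]), and the Lebesgue differentiation
    theorem identifies the density with [f''].

    From there on, increments of [f'] take the place of [f''].  The integral of a
    quadratic [p] against the increments of a function [phi] with antiderivatives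
    [g] and [G] is the increment of [p * phi - p' * g + p'' * G] ([parts_pairing]);
    when [phi] is nondecreasing and [p] is nonnegative and monotone, that increment
    is nonnegative by the mean value theorem ([parts_pairing_ge0]).  Folding [0, 1]
    about 1/2 turns the quadrature error into such an increment over [0, 1/2]
    ([quadrature_error_kernel_pairing]).  Cutting [0, 1/2] at the vertex and the
    roots of [kernel] gives the first bound ([kernel_pairing_le_l1]); applying the
    same comparison to [kernel_max - kernel] and [kernel_max + kernel] gives the
    other two ([kernel_pairing_le_max]). *)

(** * Absolute continuity over lists of intervals *)

(** Two intervals may share an endpoint, and a degenerate interval must not lie
    inside another one; for nondegenerate intervals this is disjointness of the
    interiors. *)
Definition apart {R : realType} (p q : R * R) : bool := (p.2 <= q.1) || (q.2 <= p.1).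

Definition interval_family {R : realType} (A : interval R) (s : seq (R * R)) : bool :=
  all (fun p => [&& p.1 <= p.2, p.1 \in A & p.2 \in A]) s && pairwise apart s.

(** Absolute continuity with families given as lists instead of functions on
    ordinals: concatenation, refinement and mapping of families become the list
    operations, and the ambient interval may be the whole line. *)
Definition ac_seq {R : realType} (A : interval R) (F : R -> R) : Prop :=
  forall e, 0 < e -> exists2 d, 0 < d & forall s, interval_family A s ->
    \sum_(p <- s) (p.2 - p.1) < d -> \sum_(p <- s) `|F p.2 - F p.1| <= e.

Lemma abs_cont_on_ac_seq {R : realType} (a b : R) (g : R -> R) :
  abs_cont_on a b g -> ac_seq `[a, b] g.
Proof.
move=> acg e e0; have [d d0 H] := acg e e0; exists d => // s.
move=> /andP[/allP alls /(pairwiseP (0, 0)) aparts].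
rewrite !(big_nth (0, 0)) !big_mkord => sd; apply/ltW.
apply: (H _ (fun i => (nth (0, 0) s i).1) (fun i => (nth (0, 0) s i).2)) => //.
  move=> i; have /and3P[p12] := alls _ (mem_nth (0, 0) (ltn_ord i)).
  by rewrite !in_itv/= => /andP[? _] /andP[_ ?].
apply/trivIsetP => i j _ _; wlog ij : i j / (i < j)%N.
  move=> wl ij; have [lt|lt|/val_inj eq] := ltngtP i j.
  - exact: wl.
  - by rewrite setIC; apply: wl => //; rewrite eq_sym.
  - by rewrite eq eqxx in ij.
move=> _; apply/seteqP; split=> // x [] /=; rewrite !in_itv/=.
move=> /andP[ix xi] /andP[jx xj].
have /orP[h|h] := aparts i j (ltn_ord i) (ltn_ord j) ij.
  by have := lt_trans (lt_le_trans xi h) jx; rewrite ltxx.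
by have := lt_trans (lt_le_trans xj h) ix; rewrite ltxx.
Qed.

Definition consecutive_pairs {R : realType} (x : R) (s : seq R) := zip (x :: s) s.

Lemma variation_consecutive {R : realType} (a b : R) (g : R -> R) s :
  itv_partition a b s ->
  variation a b g s = \sum_(q <- consecutive_pairs a s) `|g q.2 - g q.1|.
Proof.
move=> abs; rewrite (variation_zip _ abs) /consecutive_pairs.
by elim: s {abs} a => [|x s IH] a; rewrite ?big_nil//= !big_cons IH.
Qed.

Lemma consecutive_pairs_family {R : realType} (a b : R) s :
  itv_partition a b s ->
  [/\ all (fun q => [&& a <= q.1, q.1 <= q.2 & q.2 <= b]) (consecutive_pairs a s),
      pairwise apart (consecutive_pairs a s) &
      \sum_(q <- consecutive_pairs a s) (q.2 - q.1) = b - a].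
Proof.
rewrite /consecutive_pairs; elim: s a => [|x s IH] a.
  by move=> [_ /eqP <-]; rewrite big_nil subrr.
move=> axs; have xs := itv_partition_cons axs.
have xb := itv_partition_le xs; have ax : a < x by case: axs => /= /andP[].
have [h1 h2 h3] := IH _ xs.
split.
- rewrite /= lexx (ltW ax) xb/=; apply: sub_all h1 => q /and3P[xq q12 qb].
  by rewrite (le_trans (ltW ax) xq) q12.
- rewrite /= h2 andbT; apply: sub_all h1 => q /and3P[xq q12 qb].
  by rewrite /apart/= xq.
- by rewrite /= big_cons h3/= addrC subrKA.
Qed.

Lemma apart_refine {R : realType} (p q r : R * R) :
  p.1 <= q.1 -> q.2 <= p.2 -> apart p r -> apart q r.
Proof.
rewrite /apart => pq1 pq2 /orP[h|h]; apply/orP.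
  by left; exact: le_trans h.
by right; exact: le_trans h pq1.
Qed.

Lemma apartC {R : realType} : symmetric (@apart R).
Proof. by move=> p q; rewrite /apart orbC. Qed.

(** The crucial step for the absolute continuity of the variation: the modulus
    [d] of [g] still works when increments are replaced by variations.  The
    intervals of [t] are converted one at a time: the variation on the first one
    is a supremum over partitions, and each partition, being a family of the same
    total length, can be moved into the list [s] of plain increments. *)
Lemma total_variation_family {R : realType} (a b d e : R) (g : R -> R) :
  (forall s, interval_family `[a, b] s -> \sum_(p <- s) (p.2 - p.1) < d ->
     \sum_(p <- s) `|g p.2 - g p.1| <= e) ->
  forall t s, interval_family `[a, b] (t ++ s) ->
    \sum_(p <- t ++ s) (p.2 - p.1) < d ->
    (\sum_(p <- t) total_variation p.1 p.2 g +
     (\sum_(p <- s) `|g p.2 - g p.1|)%:E <= e%:E)%E.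
Proof.
move=> H; elim=> [|p t IH] s; first by rewrite big_nil add0e lee_fin; exact: H.
rewrite /= /interval_family /= => /andP[/andP[/and3P[p12 p1 p2] gts] /andP[pts tspw]].
rewrite big_cons => lend.
have rest_le : (\sum_(q <- t) total_variation q.1 q.2 g +
    (\sum_(q <- s) `|g q.2 - g q.1|)%:E <= e%:E)%E.
  apply: IH; rewrite /interval_family ?gts ?tspw//.
  by apply: le_lt_trans lend; rewrite lerDr subr_ge0.
have rest_ge0 : (0 <= \sum_(q <- t) total_variation q.1 q.2 g +
    (\sum_(q <- s) `|g q.2 - g q.1|)%:E)%E.
  apply: adde_ge0; last by rewrite lee_fin sumr_ge0.
  rewrite big_seq; apply: sume_ge0 => q qt; apply: total_variation_ge0.
  by have /allP/(_ q) := gts; rewrite mem_cat qt => /(_ isT)/and3P[].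
have rest_fin : (\sum_(q <- t) total_variation q.1 q.2 g +
    (\sum_(q <- s) `|g q.2 - g q.1|)%:E)%E \is a fin_num.
  by rewrite ge0_fin_numE//; apply: le_lt_trans rest_le _; rewrite ltry.
(* The remaining terms are finite, so they can cross the inequality and leave the
   supremum alone on the left. *)
rewrite big_cons -addeA -leeBrDr//; apply: ge_ereal_sup => _ [_ [l pl <-] <-].
rewrite leeBrDr// addeCA (variation_consecutive _ _ _ _ pl) -EFinD -big_cat/=.
have [l1 l2 l3] := consecutive_pairs_family _ _ _ pl.
apply: IH.
  move: gts tspw pts.
  rewrite /interval_family !all_cat => /andP[-> ->]; rewrite !andbT/=.
  rewrite !pairwise_cat l2/= => /and3P[ts -> ->] /andP[pt ps]; rewrite !andbT.
  apply/and3P; split.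
  - apply: sub_all l1 => q /and3P[pq q12 qp]; rewrite q12/=.
    move: p1 p2; rewrite !in_itv/= => /andP[ap pb] /andP[ap' pb'].
    apply/andP; split; apply/andP; split.
    + exact: le_trans pq.
    + by rewrite (le_trans q12)// (le_trans qp).
    + by rewrite (le_trans ap)// (le_trans pq).
    + exact: le_trans pb'.
  - rewrite allrel_catr ts andbT; apply/allrelP => q r qt rl.
    rewrite apartC; have /and3P[h1 _ h2] := allP l1 _ rl.
    by apply: apart_refine h1 h2 _; exact: (allP pt).
  - apply/allrelP => r q rl qs; have /and3P[h1 _ h2] := allP l1 _ rl.
    by apply: apart_refine h1 h2 _; exact: (allP ps).
rewrite big_cat/= big_cat/= l3; apply: le_lt_trans lend.
by rewrite big_cat/= addrCA.
Qed.

(** On any interval shorter than the modulus for 1 the variation is at most 1, and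
    finitely many such intervals cover [a, b]. *)
Lemma ac_seq_bounded_variation {R : realType} (a b : R) (g : R -> R) :
  a <= b -> ac_seq `[a, b] g -> bounded_variation a b g.
Proof.
move=> ab acg; have [d d0 H] := acg 1 ltr01.
have short x y : a <= x -> x <= y -> y <= b -> y - x < d ->
    (total_variation x y g <= 1%:E)%E.
  move=> ax xy yb yxd.
  have := total_variation_family _ _ _ _ _ H [:: (x, y)] [::].
  rewrite /interval_family/= !in_itv/= xy ax yb (le_trans ax xy) (le_trans xy yb)/=.
  by rewrite !big_seq1 big_nil adde0; apply.
have [n hn] : exists n : nat, (b - a) / n.+1%:R < d.
  exists (Num.bound ((b - a) / d)); rewrite ltr_pdivrMr// mulrC -ltr_pdivrMr//.
  have : 0 <= (b - a) / d by rewrite divr_ge0 ?subr_ge0// ltW.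
  by move=> /archi_boundP/lt_trans; apply; rewrite ltr_nat.
pose h := (b - a) / n.+1%:R.
have h0 : 0 <= h by rewrite divr_ge0// subr_ge0.
have nh : n.+1%:R * h = b - a by rewrite mulrC divfK// pnatr_eq0.
apply/bounded_variationP => //.
suff bvk k : (k <= n.+1)%N -> total_variation a (a + k%:R * h) g \is a fin_num.
  by have := bvk _ (leqnn _); rewrite nh subrKC.
elim: k => [_|k IH kn]; first by rewrite mul0r addr0 total_variationxx.
have kh : 0 <= k%:R * h by rewrite mulr_ge0.
have kb : a + k.+1%:R * h <= b.
  by rewrite -lerBrDl -nh ler_wpM2r// ler_nat.
rewrite (@total_variationD _ _ _ (a + k%:R * h)) ?lerDl//; last first.
  by rewrite lerD2l ler_wpM2r// ler_nat.
rewrite fin_numD (IH (ltnW kn))/=.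
have sh : a + k%:R * h <= a + k.+1%:R * h by rewrite lerD2l ler_wpM2r// ler_nat.
rewrite ge0_fin_numE; last exact: total_variation_ge0.
apply: (@le_lt_trans _ _ 1%:E); last by rewrite ltry.
apply: short => //; first by rewrite lerDl.
suff -> : a + k.+1%:R * h - (a + k%:R * h) = h by [].
by rewrite -natr1; ring.
Qed.

Definition variation_fun {R : realType} (a : R) (g : R -> R) (x : R) : R :=
  fine (total_variation a x g).

Lemma variation_funB {R : realType} (a b x y : R) (g : R -> R) :
  bounded_variation a b g -> a <= x -> x <= y -> y <= b ->
  (variation_fun a g y - variation_fun a g x)%:E = total_variation x y g.
Proof.
move=> bv ax xy yb; rewrite /variation_fun.
have fin_ax : total_variation a x g \is a fin_num.
  apply/bounded_variationP => //.
  exact: bounded_variationl (le_trans xy yb) bv.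
have fin_xy : total_variation x y g \is a fin_num.
  apply/bounded_variationP => //.
  exact: bounded_variationl yb (bounded_variationr ax (le_trans xy yb) bv).
by rewrite (total_variationD g ax xy) fineD// addrAC subrr add0r fineK.
Qed.

Lemma ac_seq_variation_fun {R : realType} (a b : R) (g : R -> R) :
  a <= b -> ac_seq `[a, b] g -> ac_seq `[a, b] (variation_fun a g).
Proof.
move=> ab acg e e0; have [d d0 H] := acg e e0; exists d => // s fs sd.
have bv := ac_seq_bounded_variation _ _ _ ab acg.
have := total_variation_family _ _ _ _ _ H s [::]; rewrite cats0 big_nil adde0.
move=> /(_ fs sd); rewrite -lee_fin; apply: le_trans.
rewrite -sumEFin big_seq [in leRHS]big_seq; apply: lee_sum => p ps.
have /andP[/allP/(_ _ ps)/and3P[p12 + +] _] := fs.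
rewrite !in_itv/= => /andP[ap _] /andP[_ pb].
rewrite -(variation_funB _ _ _ _ _ bv ap p12 pb) ger0_norm//.
by rewrite -lee_fin (variation_funB _ _ _ _ _ bv ap p12 pb) total_variation_ge0.
Qed.

Lemma ac_seqB {R : realType} (I : interval R) (F G : R -> R) :
  ac_seq I F -> ac_seq I G -> ac_seq I (F \- G).
Proof.
move=> acF acG e e0; have e2 : 0 < e / 2 by rewrite divr_gt0.
have [d1 d10 H1] := acF _ e2; have [d2 d20 H2] := acG _ e2.
exists (Num.min d1 d2); first by rewrite lt_min d10.
move=> s fs; rewrite lt_min => /andP[sd1 sd2].
rewrite (splitr e); apply: le_trans (lerD (H1 _ fs sd1) (H2 _ fs sd2)).
rewrite -big_split/=; apply: ler_sum => p _.
have -> : (F \- G) p.2 - (F \- G) p.1 = F p.2 - F p.1 - (G p.2 - G p.1).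
  by rewrite /=; ring.
exact: ler_normB.
Qed.

(** * Extension from an interval to the line *)

Definition clamp {R : realType} (a b x : R) : R := Num.max a (Num.min x b).

Lemma clamp_itv {R : realType} (a b x : R) : a <= b -> clamp a b x \in `[a, b].
Proof. by move=> ab; rewrite /clamp in_itv/= le_max lexx/= ge_max ab/= ge_min lexx orbT. Qed.

Lemma clamp_id {R : realType} (a b x : R) : x \in `[a, b] -> clamp a b x = x.
Proof. by rewrite in_itv/= /clamp => /andP[ax xb]; rewrite min_l// max_r. Qed.

Lemma clamp_le {R : realType} (a b x y : R) : x <= y ->
  0 <= clamp a b y - clamp a b x <= y - x.
Proof.
move=> xy; rewrite /clamp.
case: (leP x b) => xb; case: (leP y b) => yb; rewrite ?(minElt, maxElt);
  repeat (case: ifPn; rewrite -?leNgt => ?); apply/andP; split; lra.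
Qed.

(** Precomposition with [clamp] extends a function from [a, b] to the line by
    constants, as required of the distribution function of a measure; clamping
    keeps intervals apart and does not lengthen them. *)
Lemma ac_seq_clamp {R : realType} (a b : R) (F : R -> R) :
  a <= b -> ac_seq `[a, b] F -> ac_seq `]-oo, +oo[ (F \o clamp a b).
Proof.
move=> ab acF e e0; have [d d0 H] := acF e e0; exists d => // s.
move=> /andP[/allP alls aparts] sd.
have := H [seq (clamp a b p.1, clamp a b p.2) | p <- s]; rewrite !big_map/=; apply.
  apply/andP; split.
    apply/allP => _ /mapP[p ps ->] /=; rewrite !clamp_itv// !andbT.
    have /and3P[p12 _ _] := alls _ ps.
    by have /andP[] := clamp_le a b _ _ p12; rewrite subr_ge0.
  rewrite pairwise_map; apply: sub_pairwise aparts => p q /=.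
  rewrite /apart/= => /orP[] h; apply/orP; [left|right];
    by have /andP[] := clamp_le a b _ _ h; rewrite subr_ge0.
apply: le_lt_trans sd; rewrite big_seq [leRHS]big_seq; apply: ler_sum => p ps.
by have /and3P[p12 _ _] := alls _ ps; have /andP[] := clamp_le a b _ _ p12.
Qed.

Lemma ac_seq_uniform {R : realType} (F : R -> R) : ac_seq `]-oo, +oo[ F ->
  forall e, 0 < e -> exists2 d, 0 < d & forall x y, `|x - y| < d -> `|F x - F y| <= e.
Proof.
move=> acF e e0; have [d d0 H] := acF e e0; exists d => // x y.
wlog xy : x y / y <= x => [wl|].
  by have /orP[|] := le_total y x => ?; [exact: wl|rewrite distrC [in leLHS]distrC; exact: wl].
rewrite ger0_norm ?subr_ge0// => xyd.
by have := H [:: (y, x)]; rewrite /interval_family/= xy !in_itv/= !big_seq1; apply.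
Qed.

Lemma ac_seq_continuous {R : realType} (F : R -> R) :
  ac_seq `]-oo, +oo[ F -> continuous F.
Proof.
move=> acF x; apply/cvgrPdist_le => e e0.
have [d d0 H] := ac_seq_uniform _ acF e e0.
by exists d => // y /= xyd; exact: H.
Qed.

(** * Density of an absolutely continuous function *)

Lemma open_interval_finite {R : realType} (I : set R) :
  open I -> is_interval I -> (lebesgue_measure I < +oo)%E ->
  exists2 p : R * R, p.1 <= p.2 & I = `]p.1, p.2[%classic.
Proof.
move=> oI iI finI; have [I0|/set0P[x Ix]] := eqVneq I set0.
  by exists (0, 0) => //=; rewrite set_itvoo0.
have IE : [set` Rhull I] = I by apply: RhullK; rewrite inE.
move: Ix finI; rewrite -IE.
have oRI : open [set` Rhull I] by rewrite IE.
move: oRI; case: (Rhull I) => [[b1 a|[|]] [b2 b|[|]]] oRI;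
  rewrite /= ?in_itv/= ?lebesgue_measure_itv/= ?ltry ?ltNyr ?ltxx ?andbF//.
- move=> xab _; exists (a, b).
    by move: xab; case: b1 {oRI}; case: b2; rewrite /= => /andP[] //;
      do ?[exact: le_trans | move=> /ltW + /ltW; exact: le_trans
          | move=> /ltW; exact: le_trans | move=> + /ltW; exact: le_trans].
  by rewrite -(interior_itv_bnd a b b1 b2); apply/esym/interior_id.
Qed.

Lemma lebesgue_stieltjes_oc {R : realType} (F : cumulative R R) (a b : R) :
  a <= b -> lebesgue_stieltjes_measure F `]a, b] = (F b - F a)%:E.
Proof.
move=> ab; rewrite /lebesgue_stieltjes_measure /measure_extension.
by rewrite measurable_mu_extE/= ?wlength_itv_bnd//; exact: is_ocitv.
Qed.

Lemma disjoint_itv_apart {R : realType} (p q : R * R) :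
  p.1 < p.2 -> q.1 < q.2 -> `]p.1, p.2[ `&` `]q.1, q.2[ = set0 -> apart p q.
Proof.
move=> p12 q12 pq0; apply: contraT; rewrite negb_or -!ltNge => /andP[qp pq].
pose m := Num.max p.1 q.1; pose M := Num.min p.2 q.2.
have mM : m < M by rewrite /m /M gt_max !lt_min p12 q12 qp pq.
have [mx xM] := midf_lt mM.
suff : (set0 : set R) ((m + M) / 2) by [].
rewrite -pq0; move: mx xM; rewrite /m /M gt_max lt_min.
by move=> /andP[? ?] /andP[? ?]; split; rewrite /= in_itv/=; apply/andP.
Qed.

(** A Lebesgue-null set lies in an open set of length less than [d].  That set is a
    countable disjoint union of open intervals, the measure of any finite number of
    which is a sum of increments of [F] over a family of length less than [d],
    hence at most [e]. *)
Lemma lebesgue_stieltjes_dominated {R : realType} (F : cumulative R R) :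
  ac_seq `]-oo, +oo[ F ->
  forall A : set R, measurable A -> lebesgue_measure A = 0 ->
  lebesgue_stieltjes_measure F A = 0.
Proof.
move=> acF A mA A0; apply/eqP; rewrite eq_le measure_ge0 andbT.
apply/lee_addgt0Pr => e e0; rewrite add0e.
have [d d0 H] := acF e e0.
have [|U [oU AU UAd]] := lebesgue_regularity_outer mA _ d0.
  by rewrite [X in (X < _)%E]A0 ltry.
have mU : measurable U by exact: open_measurable.
have Ud : (lebesgue_measure U < d%:E)%E.
  rewrite -(setDUK AU); apply: le_lt_trans (measureU2 _ _ _) _ => //.
    exact: measurableD.
  by rewrite [X in (X + _ < _)%E]A0 add0e.
apply: (@le_trans _ _ (lebesgue_stieltjes_measure F U)).
  by rewrite le_measure ?inE.
have [I [Iitv Itriv UE]] := OpenSetDisjointItvs.open_disjoint_itv oU.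
have mI k : measurable (I k) by apply: open_measurable; case: (Iitv k).
have /choice[p pP] k : exists q : R * R, q.1 <= q.2 /\ I k = `]q.1, q.2[%classic.
  have [oI iI] := Iitv k.
  have [|q] := open_interval_finite _ oI iI; last by exists q.
  apply: le_lt_trans (lt_trans Ud (ltry _)).
  have IU : I k `<=` U by rewrite UE; exact: bigcup_sup.
  apply: le_measure; [exact: mem_set (mI k)|exact: mem_set mU|exact: IU].
rewrite UE measure_semi_bigcup//; last by rewrite -UE.
apply: lime_le; first by apply: is_cvg_nneseries => k _ _; exact: measure_ge0.
apply: nearW => n.
(* Empty members of the decomposition are dropped: their degenerate endpoints need
   not be apart from the other intervals. *)
pose l := [seq k <- index_iota 0 n | (p k).1 < (p k).2].
pose s := [seq p k | k <- l].
have fs : interval_family `]-oo, +oo[ s.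
  apply/andP; split.
    apply/allP => _ /mapP[k _ ->]; rewrite !in_itv/= !andbT.
    by have [] := pP k.
  rewrite /s pairwise_map; apply/(pairwiseP 0%N) => i j il jl ij.
  have pl k : k \in gtn (size l) -> (p (nth 0%N l k)).1 < (p (nth 0%N l k)).2.
    by move=> kl; have := mem_nth 0%N kl; rewrite mem_filter => /andP[].
  apply: disjoint_itv_apart; [exact: pl|exact: pl|].
  have [_ <-] := pP (nth 0%N l i); have [_ <-] := pP (nth 0%N l j).
  move/trivIsetP : Itriv; apply => //.
  by rewrite nth_uniq ?filter_uniq ?iota_uniq// ltn_eqF.
have itv0 k : ~~ ((p k).1 < (p k).2) -> I k = set0.
  by have [_ ->] := pP k; move=> h; rewrite set_itv_ge// bnd_simp.
have lenE : (\sum_(0 <= k < n) lebesgue_measure (I k))%E =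
    (\sum_(q <- s) (q.2 - q.1))%:E.
  rewrite big_map big_filter [in RHS]big_mkcond/= -sumEFin; apply: eq_bigr => k _.
  case: ifPn => [pk|/itv0 ->]; last exact: measure0.
  have [_ ->] := pP k; rewrite [LHS]lebesgue_measure_itv/= lte_fin pk.
  by rewrite EFinB.
have sd : \sum_(q <- s) (q.2 - q.1) < d.
  rewrite -lte_fin -lenE; apply: le_lt_trans Ud.
  rewrite [in leRHS]UE measure_semi_bigcup//; last by rewrite -UE.
  by apply: nneseries_lim_ge => k _ _; exact: measure_ge0.
apply: (@le_trans _ _ (\sum_(q <- s) `|F q.2 - F q.1|)%:E); last first.
  by rewrite lee_fin; exact: H.
rewrite big_map big_filter [in leRHS]big_mkcond/= -sumEFin; apply: lee_sum => k _.
case: ifPn => [pk|/itv0 ->]; last by rewrite measure0.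
have [pk' ->] := pP k.
apply: (@le_trans _ _ (lebesgue_stieltjes_measure F `](p k).1, (p k).2])).
  by rewrite le_measure ?inE//; exact: subset_itv_oo_oc.
by rewrite lebesgue_stieltjes_oc// lee_fin ler_norm.
Qed.

Lemma ac_nondecreasing_density {R : realType} (a b : R) (F : R -> R) :
  {homo F : x y / x <= y} -> ac_seq `]-oo, +oo[ F ->
  exists2 h : R -> R, lebesgue_measure.-integrable setT (EFin \o h) &
    forall x y, a <= x -> x <= y -> y <= b ->
      F y - F x = (\int[lebesgue_measure]_(t in `]x, y]) h t)%R.
Proof.
move=> ndF acF.
have rcF : right_continuous F.
  by apply: right_continuousW; exact: ac_seq_continuous.
pose cF : cumulative R R := HB.pack F (isCumulative.Build R _ R F ndF rcF).
have [ba|ab] := ltP b a.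
  exists (cst 0) => [|x y ax xy yb]; first exact: integrable0.
  by have := le_lt_trans (le_trans (le_trans ax xy) yb) ba; rewrite ltxx.
have mD : measurable (`]a, b]%classic : set (measurableTypeR R)) by exact: measurable_itv.
have Dfin : (lebesgue_stieltjes_measure cF `]a, b] < +oo)%E.
  by rewrite lebesgue_stieltjes_oc// ltry.
(* The Radon-Nikodym theorem wants a finite measure, hence the restriction. *)
pose nu : {finite_measure set (measurableTypeR R) -> \bar R} := mfrestr mD Dfin.
pose mu : {sigma_finite_measure set (measurableTypeR R) -> \bar R} :=
  @lebesgue_measure R.
have dom : nu `<< mu.
  apply/null_content_dominatesP => A mA A0.
  apply: (@lebesgue_stieltjes_dominated R cF acF); first exact: measurableI.
  apply/eqP; rewrite eq_le measure_ge0 andbT -[leRHS]A0.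
  apply: le_measure; [exact: mem_set (measurableI _ _ mA mD)|exact: mem_set|].
  exact: subIsetl.
have [h [h0 hfin inth nuE]] := radon_nikodym_sigma_finite dom.
have hE : h = EFin \o (fine \o h) by apply/funext => t /=; rewrite fineK.
exists (fine \o h); first by rewrite -hE.
move=> x y ax xy yb; rewrite /Rintegral.
have -> : (\int[lebesgue_measure]_(t in `]x, y]) ((fine \o h) t)%:E)%E =
    nu `]x, y]%classic.
  rewrite nuE; last exact: measurable_itv.
  by apply: eq_integral => t _ /=; rewrite fineK.
have -> : nu `]x, y]%classic =
    lebesgue_stieltjes_measure cF (`]x, y]%classic `&` `]a, b]%classic) by [].
rewrite setIidl; last first.
  by apply: subset_itv; rewrite bnd_simp.
by rewrite lebesgue_stieltjes_oc.
Qed.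

(** The fundamental theorem of calculus for absolutely continuous functions, by the
    Jordan decomposition [g = V - (V - g)] into nondecreasing functions. *)
Lemma ac_density {R : realType} (a b : R) (g : R -> R) :
  a <= b -> abs_cont_on a b g ->
  exists2 k : R -> R, lebesgue_measure.-integrable setT (EFin \o k) &
    forall x y, a <= x -> x <= y -> y <= b ->
      g y - g x = (\int[lebesgue_measure]_(t in `]x, y]) k t)%R.
Proof.
move=> ab /abs_cont_on_ac_seq acg.
have bv := ac_seq_bounded_variation _ _ _ ab acg.
pose V := variation_fun a g.
have acV : ac_seq `[a, b] V by exact: ac_seq_variation_fun.
have acW : ac_seq `[a, b] (V \- g) by exact: ac_seqB.
have incr x y : a <= x -> x <= y -> y <= b ->
    0 <= V y - V x /\ 0 <= (V y - g y) - (V x - g x).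
  move=> ax xy yb; have VE := variation_funB _ _ _ _ _ bv ax xy yb.
  split; first by rewrite -lee_fin VE total_variation_ge0.
  have : `|g y - g x| <= V y - V x by rewrite -lee_fin VE total_variation_ge.
  by have := ler_norm (g y - g x); lra.
have monoclamp (F : R -> R) : (forall x y, a <= x -> x <= y -> y <= b -> 0 <= F y - F x) ->
    {homo F \o clamp a b : x y / x <= y}.
  move=> ndF x y xy; rewrite -subr_ge0 /=.
  have := clamp_itv _ _ x ab; have := clamp_itv _ _ y ab; rewrite !in_itv/=.
  move=> /andP[_ yb] /andP[ax _]; apply: ndF => //.
  by have /andP[] := clamp_le a b _ _ xy; rewrite subr_ge0.
have [hV intV VE] := ac_nondecreasing_density a b _
  (monoclamp _ (fun x y ax xy yb => (incr x y ax xy yb).1)) (ac_seq_clamp _ _ _ ab acV).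
have [hW intW WE] := ac_nondecreasing_density a b _
  (monoclamp _ (fun x y ax xy yb => (incr x y ax xy yb).2)) (ac_seq_clamp _ _ _ ab acW).
exists (hV \- hW).
  have -> : EFin \o (hV \- hW) = ((EFin \o hV) \- (EFin \o hW))%E.
    by apply/funext => t /=; rewrite EFinB.
  exact: integrableB.
move=> x y ax xy yb.
have mxy : measurable (`]x, y]%classic : set R) by exact: measurable_itv.
rewrite RintegralB//; last 2 first.
- exact: integrableS intV.
- exact: integrableS intW.
rewrite -VE// -WE//=.
have xab : x \in `[a, b] by rewrite in_itv/= ax (le_trans xy).
have yab : y \in `[a, b] by rewrite in_itv/= yb andbT (le_trans ax).
by rewrite !clamp_id//; lra.
Qed.

(** * Derivatives along the unit interval *)

Lemma nbhs_unit_itv {R : realType} (x : R) : x \in `]0, 1[%R -> nbhs x (@unit_itv R).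
Proof.
move=> x01; apply: filterS (near_in_itvoo x01) => y.
exact: subset_itv_oo_cc.
Qed.

Lemma within_unit_itv_dnbhs {R : realType} (x : R) :
  x \in `]0, 1[%R -> within unit_itv x^' = x^'.
Proof.
move=> /nbhs_unit_itv nx; apply/seteqP; split=> U /= hU; last first.
  by apply: filterS hU => y Uy _.
apply: (@filterS2 _ (nbhs x) _ _ _ _ _ hU nx) => y h A yx; exact: h.
Qed.

(** In the interior the difference quotient along [unit_itv] is the usual one, up to
    the translation from increments to points. *)
Lemma is_derive_cvg_unit_itv {R : realType} (f : R -> R) (x l : R) :
  x \in `]0, 1[%R ->
  (f y - f x) / (y - x) @[y --> within unit_itv x^'] --> l <->
  is_derive x (1:R) f l.
Proof.
move=> x01; rewrite (within_unit_itv_dnbhs _ x01).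
have shiftE : (f y - f x) / (y - x) @[y --> x^'] =
    h^-1 *: ((f \o shift x) (h *: (1 : R)) - f x) @[h --> 0^'].
  apply/seteqP; split=> U /= hU.
    have : \forall y \near x, y != x -> U ((f y - f x) / (y - x)) := hU.
    rewrite (near_shift 0 x) => hU'.
    suff : \forall h \near 0, h != 0 ->
      U (h^-1 *: ((f \o shift x) (h *: (1 : R)) - f x)) by [].
    apply: filterS hU' => h /=; rewrite subr0 => hU' h0.
    have := hU' _; rewrite -subr_eq0 addrK => /(_ h0).
    by rewrite [_ *: 1]mulr1 mulrC.
  have : \forall h \near 0, h != 0 ->
      U (h^-1 *: ((f \o shift x) (h *: (1 : R)) - f x)) := hU.
  rewrite (near_shift x 0) => hU'.
  suff : \forall y \near x, y != x -> U ((f y - f x) / (y - x)) by [].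
  apply: filterS hU' => y /=; rewrite sub0r => hU' yx.
  have := hU' _; rewrite subr_eq0 => /(_ yx).
  by rewrite [_ *: 1]mulr1 subrK mulrC.
rewrite shiftE; split=> [h|dfl].
  apply: DeriveDef; last by apply/cvg_lim.
  by apply/cvg_ex; exists l.
by have := @ex_derive _ _ _ _ _ _ _ dfl; rewrite /derivable => /cvg_ex[l' h];
  have <- : 'D_1 f x = l; [exact: derive_val|rewrite /derive (cvg_lim _ h)].
Qed.

Lemma derivable_on_is_derive {R : realType} (f : R -> R) (x : R) :
  x \in `]0, 1[%R -> derivable_on unit_itv f x ->
  is_derive x (1:R) f (derive_on unit_itv f x).
Proof. by move=> x01 dfx; apply/(is_derive_cvg_unit_itv _ _ _ x01). Qed.

Lemma derive_on_is_derive {R : realType} (f : R -> R) (x l : R) :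
  x \in `]0, 1[%R -> is_derive x (1:R) f l -> derive_on unit_itv f x = l.
Proof.
move=> x01 /(is_derive_cvg_unit_itv _ _ _ x01) h.
have pF : ProperFilter (within unit_itv x^').
  by rewrite (within_unit_itv_dnbhs _ x01); exact: _.
by apply: cvg_lim.
Qed.

(** Write [f y] as [f x] plus the difference quotient times [y - x]. *)
Lemma derivable_on_within_continuous {R : realType} (f : R -> R) :
  (forall x, unit_itv x -> derivable_on unit_itv f x) ->
  {within `[0, 1], continuous f}.
Proof.
move=> df; apply/subspace_continuousP => x x01.
have /cvg_ex[l hl] := df _ x01.
have h : f x + (f y - f x) / (y - x) * (y - x) @[y --> within unit_itv x^']
    --> f x + l * (x - x).
  apply: cvgD; first exact: cvg_cst.
  apply: cvgM => //.
  apply: (@cvg_trans _ ((y - x) @[y --> nbhs x])).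
    apply: cvg_app => U hU; apply: filterS hU => y Uy _ _; exact: Uy.
  by apply: cvgB; [exact: cvg_id|exact: cvg_cst].
move=> U fU; have : nbhs (f x + l * (x - x)) U by rewrite subrr mulr0 addr0.
move=> /h; rewrite /nbhs/= /dnbhs /within/= => hU.
apply: (@filterS _ (nbhs x) _ _ _ _ hU) => y /= Uy y01.
have [->|yx] := eqVneq y x; first exact: nbhs_singleton fU.
have := Uy yx y01; rewrite divfK ?subr_eq0// subrKC; exact.
Qed.

(** * Slope bounds from almost everywhere bounds *)

Lemma ac_density_is_derive {R : realType} (a b : R) (g k : R -> R) :
  lebesgue_measure.-integrable setT (EFin \o k) ->
  (forall x y, a <= x -> x <= y -> y <= b ->
     g y - g x = (\int[lebesgue_measure]_(t in `]x, y]) k t)%R) ->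
  {ae lebesgue_measure, forall x : R, x \in `]a, b[ -> is_derive x (1:R) g (k x)}.
Proof.
move=> intk gE.
have intay (y : R) : lebesgue_measure.-integrable `]a, y] (EFin \o k).
  by apply: integrableS intk.
have locf : locally_integrable [set: R] k.
  by apply: open_integrable_locally => //; exact: openT.
have := FTC1 (a := BRight a) intay locf.
apply: filterS; first exact: (ae_filter_ringOfSetsType lebesgue_measure).
move=> x /= dF xab.
have /andP[ax xb] : a < x < b by move: xab; rewrite in_itv.
have {dF}[dF FE] := dF ax.
pose F y := (\int[lebesgue_measure]_(t in `]a, y]) k t)%R.
have dF' : is_derive x (1:R) (fun y => F y + g a) (k x).
  have dFx : is_derive x (1:R) F (k x).
    by rewrite -FE derive1E; exact: derivableP.
  by rewrite -[k x]addr0; exact: is_deriveD.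
apply: near_eq_is_derive dF'.
apply: filterS (near_in_itvoo xab) => y; rewrite in_itv/= => /andP[ay yb].
by rewrite /F -gE ?subrK// ltW.
Qed.

Lemma ae_Rintegral_ge0 {R : realType} (D : set R) (h : R -> R) :
  measurable D -> lebesgue_measure.-integrable D (EFin \o h) ->
  {ae lebesgue_measure, forall t, D t -> 0 <= h t} ->
  (0 <= \int[lebesgue_measure]_(t in D) h t)%R.
Proof.
move=> mD inth h0.
have mh : measurable_fun D h by apply/measurable_EFinP; exact: measurable_int inth.
have mh' : measurable_fun D (EFin \o (h \max cst 0)).
  by apply/measurable_EFinP; apply: measurable_maxr => //; exact: measurable_cst.
have hE : (\int[lebesgue_measure]_(t in D) (h t)%:E =
    \int[lebesgue_measure]_(t in D) (EFin \o (h \max cst 0)%R) t)%E.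
  apply: ae_eq_integral => //; first exact/measurable_EFinP.
  apply: filterS h0; first exact: (ae_filter_ringOfSetsType lebesgue_measure).
  by move=> t h0 Dt; rewrite /= max_l ?h0.
rewrite /Rintegral hE; apply: fine_ge0; apply: integral_ge0 => t _.
by rewrite lee_fin /= le_max lexx orbT.
Qed.

(** The density of [g] is almost everywhere its derivative, so it inherits the bounds,
    and increments of [g] are integrals of the density. *)
Lemma derivative_bounds_of_ac {R : realType} (g : R -> R) (l u : R) :
  abs_cont_on 0 1 g ->
  {ae lebesgue_measure, forall t, unit_itv t -> l <= derive_on unit_itv g t <= u} ->
  forall x y, 0 <= x -> x <= y -> y <= 1 ->
    l * (y - x) <= g y - g x <= u * (y - x).
Proof.
move=> acg aeg; have [k intk gE] := ac_density _ _ _ ler01 acg.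
have aek : {ae lebesgue_measure, forall t, t \in `]0, 1[ -> l <= k t <= u}.
  apply: filterS2 aeg (ac_density_is_derive _ _ _ _ intk gE).
    exact: (ae_filter_ringOfSetsType lebesgue_measure).
  move=> t lu dg t01.
  rewrite -(derive_on_is_derive _ _ _ t01 (dg t01)); apply: lu.
  exact: subset_itv_oo_cc t01.
move=> x y x0 xy y1; rewrite gE//.
have mD : measurable (`]x, y[%classic : set R) by exact: measurable_itv.
have intD : lebesgue_measure.-integrable (`]x, y[%classic : set R) (EFin \o k).
  exact: integrableS intk.
have intc (c : R) : lebesgue_measure.-integrable (`]x, y[%classic : set R) (EFin \o cst c).
  have : lebesgue_measure.-integrable (`[x, y]%classic : set R) (EFin \o cst c).
    apply: continuous_compact_integrable; first exact: segment_compact.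
    by apply: continuous_subspaceT => t; exact: cvg_cst.
  apply: integrableS => //; exact: subset_itv_oo_cc.
have lenD : fine (lebesgue_measure (`]x, y[%classic : set R)) = y - x.
  rewrite lebesgue_measure_itv/= lte_fin.
  by case: ltP => //= yx; apply/esym/eqP; rewrite subr_eq0 eq_le yx.
have sub01 t : (`]x, y[%classic : set R) t -> t \in `]0, 1[.
  rewrite /= !in_itv/= => /andP[xt ty].
  by rewrite (le_lt_trans x0 xt)/= (lt_le_trans ty y1).
rewrite -Rintegral_itv_bndo_bndc//.
apply/andP; split; rewrite -subr_ge0 -lenD -Rintegral_cst//.
- rewrite -RintegralB//; try exact: intc.
  apply: ae_Rintegral_ge0 => //; last first.
    apply: filterS aek; first exact: (ae_filter_ringOfSetsType lebesgue_measure).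
    by move=> t lu /sub01/lu/andP[lk _]; rewrite subr_ge0.
  have -> : EFin \o (fun t => k t - l) = ((EFin \o k) \- (EFin \o cst l))%E.
    by apply/funext => t /=; rewrite EFinB.
  exact: integrableB.
- rewrite -RintegralB//; try exact: intc.
  apply: ae_Rintegral_ge0 => //; last first.
    apply: filterS aek; first exact: (ae_filter_ringOfSetsType lebesgue_measure).
    by move=> t lu /sub01/lu/andP[_ ku]; rewrite subr_ge0.
  have -> : EFin \o (fun t => u - k t) = ((EFin \o cst u) \- (EFin \o k))%E.
    by apply/funext => t /=; rewrite EFinB.
  exact: integrableB.
Qed.
(** * Integration by parts against a quadratic *)

Definition quad {R : realType} (A B C t : R) : R := A * t ^+ 2 + B * t + C.

(** With [phi], [g], [G] successive derivatives and [p] the quadratic, this is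
    [p * phi - p' * g + p'' * G].  Since [p] has no third derivative, its increments
    are the integrals of [p] against d[phi], yet it makes sense without any
    differentiability of [phi]. *)
Definition parts_pairing {R : realType} (A B C : R) (phi g G : R -> R) (t : R) : R :=
  quad A B C t * phi t - (2 * A * t + B) * g t + 2 * A * G t.

Definition antiderivative_chain {R : realType} (a b : R) (phi g G : R -> R) : Prop :=
  [/\ forall x, x \in `]a, b[%R -> is_derive x (1:R) g (phi x),
      forall x, x \in `]a, b[%R -> is_derive x (1:R) G (g x),
      {within `[a, b], continuous g} & {within `[a, b], continuous G}].

(** Replace [phi] by its value [s] at the endpoint where [p] is largest.  The
    resulting function [h s] has derivative [p' * (s - phi)], which is nonnegative
    as [p'] and [s - phi] have the same sign; the error made by the replacement is
    the value of [p] at the other endpoint times the increment of [phi].  The last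
    hypothesis says that [p] is monotone on [a, b], its derivative being affine. *)
Lemma parts_pairing_ge0 {R : realType} (a b A B C : R) (phi g G : R -> R) :
  a <= b -> antiderivative_chain a b phi g G ->
  (forall x y, a <= x -> x <= y -> y <= b -> phi x <= phi y) ->
  0 <= quad A B C a -> 0 <= quad A B C b ->
  (0 <= 2 * A * a + B /\ 0 <= 2 * A * b + B) \/
  (2 * A * a + B <= 0 /\ 2 * A * b + B <= 0) ->
  parts_pairing A B C phi g G a <= parts_pairing A B C phi g G b.
Proof.
move=> ab [dg dG cg cG] ndphi pa pb slope.
have phiab : phi a <= phi b by apply: ndphi.
(* An affine function keeps on [a, b] the sign that it has at both ends. *)
have slope_in x : x \in `]a, b[%R ->
    (0 <= 2 * A * a + B /\ 0 <= 2 * A * b + B -> 0 <= 2 * A * x + B) /\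
    (2 * A * a + B <= 0 /\ 2 * A * b + B <= 0 -> 2 * A * x + B <= 0).
  rewrite in_itv/= => /andP[ax xb].
  have e : (b - a) * (2 * A * x + B) =
    (b - x) * (2 * A * a + B) + (x - a) * (2 * A * b + B) by ring.
  have ba : 0 < b - a by lra.
  split=> -[ea eb].
    rewrite -(pmulr_rge0 _ ba) e addr_ge0// mulr_ge0//; lra.
  rewrite -(pmulr_rle0 _ ba) e -oppr_ge0 opprD -!mulrN.
  rewrite addr_ge0// mulr_ge0// ?oppr_ge0//; lra.
pose h s t := quad A B C t * s - (2 * A * t + B) * g t + 2 * A * G t.
have dh s x : x \in `]a, b[%R ->
    is_derive x (1:R) (h s) ((2 * A * x + B) * (s - phi x)).
  move=> xab; have dgx := dg _ xab; have dGx := dG _ xab.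
  rewrite /h /quad.
  apply: is_derive_eq; rewrite /GRing.scale/=; ring.
have cq : continuous (fun t : R => quad A B C t).
  move=> z; apply: cvgD; last exact: cvg_cst.
  apply: cvgD; first by apply: cvgM; [exact: cvg_cst|exact: exprn_continuous].
  by apply: cvgM; [exact: cvg_cst|exact: cvg_id].
have cl : continuous (fun t : R => 2 * A * t + B).
  move=> z; apply: cvgD; last exact: cvg_cst.
  by apply: cvgM; [exact: cvg_cst|exact: cvg_id].
have ch s : {within `[a, b], continuous (h s)}.
  move=> x; apply: cvgD; first apply: cvgB.
  - by apply: cvgM; [exact: (continuous_subspaceT cq)|exact: cvg_cst].
  - by apply: cvgM; [exact: (continuous_subspaceT cl)|exact: cg].
  - by apply: cvgM; [exact: cvg_cst|exact: cG].
have hle s : (forall x, x \in `]a, b[%R -> 0 <= (2 * A * x + B) * (s - phi x)) ->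
    h s a <= h s b.
  move=> h0; have := lexx b; have := ab; have := lexx a.
  apply: (@ger0_derive1_ndecr R (h s) a b _ _ (ch s)).
    by move=> x /(dh s)/@ex_derive.
  by move=> x xab; have dhx := dh s _ xab; rewrite derive1E derive_val h0.
rewrite /parts_pairing.
case: slope => slope.
- have : h (phi b) a <= h (phi b) b.
    apply: hle => x xab; rewrite mulr_ge0// ?subr_ge0.
      by case: (slope_in _ xab) => + _; apply.
    by move: xab; rewrite in_itv/= => /andP[ax xb]; apply: ndphi => //; exact: ltW.
  have : 0 <= quad A B C a * (phi b - phi a) by rewrite mulr_ge0// subr_ge0.
  rewrite /h; lra.
- have : h (phi a) a <= h (phi a) b.
    apply: hle => x xab; rewrite mulr_le0// ?subr_le0.
      by case: (slope_in _ xab) => _; apply.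
    by move: xab; rewrite in_itv/= => /andP[ax xb]; apply: ndphi => //; exact: ltW.
  have : 0 <= quad A B C b * (phi b - phi a) by rewrite mulr_ge0// subr_ge0.
  rewrite /h; lra.
Qed.

(** The shift by a linear function turns bounds on the slope of [phi] into
    monotonicity. *)
Lemma antiderivative_chain_affine {R : realType} (a b s l : R) (phi g G : R -> R) :
  antiderivative_chain a b phi g G ->
  antiderivative_chain a b (fun t => s * phi t + l * t)
    (fun t => s * g t + l / 2 * t ^+ 2) (fun t => s * G t + l / 6 * t ^+ 3).
Proof.
move=> [dg dG cg cG]; split.
- move=> x xab; have dgx := dg _ xab; apply: is_derive_eq.
  by rewrite /GRing.scale/=; field.
- move=> x xab; have dGx := dG _ xab; apply: is_derive_eq.
  by rewrite /GRing.scale/=; field.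
- have c2 : continuous (fun t : R => l / 2 * t ^+ 2).
    by move=> z; apply: cvgM; [exact: cvg_cst|exact: exprn_continuous].
  move=> x; apply: cvgD; last exact: (continuous_subspaceT c2).
  by apply: cvgM; [exact: cvg_cst|exact: cg].
- have c3 : continuous (fun t : R => l / 6 * t ^+ 3).
    by move=> z; apply: cvgM; [exact: cvg_cst|exact: exprn_continuous].
  move=> x; apply: cvgD; last exact: (continuous_subspaceT c3).
  by apply: cvgM; [exact: cvg_cst|exact: cG].
Qed.

Definition quad_prim {R : realType} (A B C t : R) : R :=
  A / 3 * t ^+ 3 + B / 2 * t ^+ 2 + C * t.

Lemma parts_pairing_bounds {R : realType} (a b A B C l u : R) (phi g G : R -> R) :
  a <= b -> antiderivative_chain a b phi g G ->
  (forall x y, a <= x -> x <= y -> y <= b ->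
    l * (y - x) <= phi y - phi x <= u * (y - x)) ->
  0 <= quad A B C a -> 0 <= quad A B C b ->
  (0 <= 2 * A * a + B /\ 0 <= 2 * A * b + B) \/
  (2 * A * a + B <= 0 /\ 2 * A * b + B <= 0) ->
  l * (quad_prim A B C b - quad_prim A B C a)
    <= parts_pairing A B C phi g G b - parts_pairing A B C phi g G a
    <= u * (quad_prim A B C b - quad_prim A B C a).
Proof.
move=> ab ch lip pa pb slope.
have key s m : (forall x y, a <= x -> x <= y -> y <= b ->
    0 <= s * (phi y - phi x) + m * (y - x)) ->
    0 <= s * (parts_pairing A B C phi g G b - parts_pairing A B C phi g G a)
       + m * (quad_prim A B C b - quad_prim A B C a).
  move=> nd.
  have := @parts_pairing_ge0 R a b A B C _ _ _ ab
    (antiderivative_chain_affine _ _ s m _ _ _ ch) _ pa pb slope.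
  rewrite -subr_ge0 => h.
  apply: (le_trans (h _)).
    by move=> x y ax xy yb; have := nd _ _ ax xy yb; lra.
  rewrite le_eqVlt; apply/orP; left; apply/eqP.
  by rewrite /parts_pairing /quad /quad_prim; field.
have h1 : 0 <= -1 * (parts_pairing A B C phi g G b - parts_pairing A B C phi g G a)
    + u * (quad_prim A B C b - quad_prim A B C a).
  by apply: key => x y ax xy yb; have /andP[] := lip _ _ ax xy yb; lra.
have h2 : 0 <= 1 * (parts_pairing A B C phi g G b - parts_pairing A B C phi g G a)
    + - l * (quad_prim A B C b - quad_prim A B C a).
  by apply: key => x y ax xy yb; have /andP[] := lip _ _ ax xy yb; lra.
by apply/andP; split; lra.
Qed.

Lemma antiderivative_chain_sub {R : realType} (a b c d : R) (phi g G : R -> R) :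
  a <= c -> d <= b ->
  antiderivative_chain a b phi g G -> antiderivative_chain c d phi g G.
Proof.
move=> ac db [dg dG cg cG].
have so x : x \in `]c, d[%R -> x \in `]a, b[%R.
  by rewrite !in_itv/= => /andP[cx xd]; rewrite (le_lt_trans ac)//= (lt_le_trans xd).
have sc : `[c, d] `<=` `[a, b].
  by move=> x /=; rewrite !in_itv/= => /andP[cx xd]; rewrite (le_trans ac)//= (le_trans xd).
split; [by move=> x /so/dg|by move=> x /so/dG| |].
  exact: (continuous_subspaceW sc).
exact: (continuous_subspaceW sc).
Qed.

(** * The Peano kernel of the quadrature rule *)

Section kernel.
Context {R : realType}.
Implicit Types (t a b s N l u : R) (phi g G : R -> R).

Local Notation r2 := (Num.sqrt 2 : R).
Local Notation r3 := (Num.sqrt 3 : R).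

(** The value that makes the mean of [kernel] over [0, 1/2] vanish. *)
Definition kernel_cst : R := (3 * r2 - 4) / 96.
Definition kernel_vertex : R := r2 / 8.
(** Half the distance between the two roots of [kernel], which are symmetric about
    [kernel_vertex]; it equals (3 - sqrt 2) / (4 sqrt 6). *)
Definition kernel_radius : R := (3 * r2 - 2) * r3 / 24.
Definition kernel_max : R := 1 / 12 - r2 / 32.

Definition kernel t := quad (1 / 2) (- r2 / 8) kernel_cst t.
Definition kernel_prim t := quad_prim (1 / 2) (- r2 / 8) kernel_cst t.
Definition kernel_pairing phi g G t :=
  parts_pairing (1 / 2) (- r2 / 8) kernel_cst phi g G t.

Local Notation c := kernel_cst.
Local Notation m := kernel_vertex.
Local Notation w := kernel_radius.
Local Notation M := kernel_max.

Lemma sqrt2_sq : r2 * r2 = 2.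
Proof. by rewrite -expr2 sqr_sqrtr. Qed.

Lemma sqrt3_sq : r3 * r3 = 3.
Proof. by rewrite -expr2 sqr_sqrtr. Qed.

Lemma sqrt2_bounds : 141 / 100 <= r2 <= 142 / 100.
Proof.
have := sqrt2_sq; have : 0 <= r2 by exact: sqrtr_ge0.
by move: r2 => r r0 rr; apply/andP; split; nra.
Qed.

Lemma sqrt3_bounds : 173 / 100 <= r3 <= 174 / 100.
Proof.
have := sqrt3_sq; have : 0 <= r3 by exact: sqrtr_ge0.
by move: r3 => r r0 rr; apply/andP; split; nra.
Qed.

Lemma kernel_radius_sq : w ^+ 2 = (11 - 6 * r2) / 96.
Proof.
transitivity ((9 * (r2 * r2) - 12 * r2 + 4) * (r3 * r3) / 576).
  by rewrite /w; field.
by rewrite sqrt2_sq sqrt3_sq; field.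
Qed.

Lemma kernel_radius_cube : w ^+ 3 = r3 * (45 * r2 - 58) / 2304.
Proof.
rewrite exprS kernel_radius_sq /w.
transitivity (r3 * (45 * r2 - 22 - 18 * (r2 * r2)) / 2304); first by field.
by rewrite sqrt2_sq; field.
Qed.

Lemma kernel_nodes_order : [/\ 0 <= m - w, m - w <= m, m <= m + w & m + w <= 1 / 2].
Proof.
have := sqrt2_bounds; have := sqrt3_bounds; rewrite /m /w.
move: r2 r3 => x y /andP[? ?] /andP[? ?]; split; nra.
Qed.

Lemma kernel_max_ge : 0 <= c <= M.
Proof.
rewrite /c /M; have := sqrt2_bounds.
by move: r2 => r /andP[? ?]; apply/andP; split; lra.
Qed.

Lemma kernel_radius_le_max : w ^+ 2 / 2 <= M.
Proof.
rewrite kernel_radius_sq /M; have := sqrt2_bounds.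
by move: r2 => r /andP[? ?]; lra.
Qed.

Lemma kernel_centered t : kernel (m + t) = (t ^+ 2 - w ^+ 2) / 2.
Proof.
rewrite kernel_radius_sq /kernel /quad /m.
transitivity (1 / 2 * (t ^+ 2 - (r2 * r2) / 64) + c); first by field.
by rewrite sqrt2_sq /c; field.
Qed.

Lemma kernel_at_vertex : kernel m = - (w ^+ 2 / 2).
Proof. by rewrite -[m]addr0 kernel_centered; ring. Qed.

Lemma kernel_root_left : kernel (m - w) = 0.
Proof. by rewrite kernel_centered; ring. Qed.

Lemma kernel_root_right : kernel (m + w) = 0.
Proof. by rewrite kernel_centered; ring. Qed.

Lemma kernel_at0 : kernel 0 = c.
Proof. by rewrite /kernel /quad; ring. Qed.

Lemma kernel_at_half : kernel (1 / 2) = M.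
Proof. by rewrite /kernel /quad /c /M; field. Qed.

Lemma kernel_prim0 : kernel_prim 0 = 0.
Proof. by rewrite /kernel_prim /quad_prim; ring. Qed.

(** Together with [kernel_prim0]: the kernel has mean zero on [0, 1/2], which is why
    only differences [u - l] and [S - l / 2] occur in the final bounds. *)
Lemma kernel_prim_half : kernel_prim (1 / 2) = 0.
Proof. by rewrite /kernel_prim /quad_prim /c; field. Qed.

(** The negative part of the kernel has integral - 2/3 w^3 between the roots.  As the
    mean is zero, the positive part has the opposite one, so this quantity is half
    the L^1 norm of the kernel on [0, 1/2]. *)
Lemma kernel_prim_radius : kernel_prim (m - w) - kernel_prim (m + w) =
  (5 / 96 * Num.sqrt 6 - 29 / 432 * r3) / 4.
Proof.
have -> : Num.sqrt 6 = r2 * r3 by rewrite -sqrtrM//; congr Num.sqrt; ring.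
transitivity ((r2 * r2 / 64 - 2 * c) * w - w ^+ 3 / 3).
  by rewrite /kernel_prim /quad_prim /m; field.
have -> : r2 * r2 / 64 - 2 * c = w ^+ 2.
  by rewrite sqrt2_sq kernel_radius_sq /c; field.
by rewrite -exprSr kernel_radius_cube; field.
Qed.

(** The comparison for all the quadratics that are needed: [kernel] and its opposite
    for the L^1 bound ([N = 0]), and [kernel_max] plus or minus [kernel] for the
    bounds by the maximum.  They all have their vertex at [kernel_vertex], so each
    is monotone on either side of it. *)
Lemma kernel_pairing_bounds l u s N a b phi g G :
  antiderivative_chain 0 (1 / 2) phi g G ->
  (forall x y, 0 <= x -> x <= y -> y <= 1 / 2 ->
    l * (y - x) <= phi y - phi x <= u * (y - x)) ->
  0 <= a -> a <= b -> b <= 1 / 2 ->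
  0 <= s * kernel a + N -> 0 <= s * kernel b + N ->
  m <= a \/ b <= m ->
  l * (s * (kernel_prim b - kernel_prim a) + N * (b - a))
    <= s * (kernel_pairing phi g G b - kernel_pairing phi g G a)
       + N * (phi b - phi a)
    <= u * (s * (kernel_prim b - kernel_prim a) + N * (b - a)).
Proof.
move=> ch lip a0 ab bh Ka Kb side.
have quadE t : quad (s / 2) (- s * r2 / 8) (s * c + N) t = s * kernel t + N.
  by rewrite /kernel /quad; field.
have := @parts_pairing_bounds R a b (s / 2) (- s * r2 / 8) (s * c + N) l u phi g G ab.
rewrite !quadE => /(_ (antiderivative_chain_sub _ _ _ _ _ _ _ a0 bh ch)).
have -> : parts_pairing (s / 2) (- s * r2 / 8) (s * c + N) phi g G b -
    parts_pairing (s / 2) (- s * r2 / 8) (s * c + N) phi g G a =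
    s * (kernel_pairing phi g G b - kernel_pairing phi g G a)
      + N * (phi b - phi a).
  by rewrite /kernel_pairing /parts_pairing /quad; field.
have -> : quad_prim (s / 2) (- s * r2 / 8) (s * c + N) b -
    quad_prim (s / 2) (- s * r2 / 8) (s * c + N) a =
    s * (kernel_prim b - kernel_prim a) + N * (b - a).
  by rewrite /kernel_prim /quad_prim; field.
apply => //.
  by move=> x y ax xy yb; apply: lip => //; [exact: le_trans ax|exact: le_trans yb bh].
have slopeE t : 2 * (s / 2) * t + - s * r2 / 8 = s * (t - m) by rewrite /m; field.
rewrite !slopeE; case: side => h.
- have h' := le_trans h ab.
  case: (leP 0 s) => s0; [left|right; have {}s0 := ltW s0].
    by split; rewrite mulr_ge0// subr_ge0.
  by split; rewrite mulr_le0_ge0// subr_ge0.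
- have h' := le_trans ab h.
  case: (leP 0 s) => s0; [right|left; have {}s0 := ltW s0].
    by split; rewrite mulr_ge0_le0// subr_le0.
  by split; rewrite mulr_le0// subr_le0.
Qed.

(** The nodes are the roots and the vertex; the kernel is positive on the outer two
    pieces and negative on the inner two, where its opposite is used. *)
Lemma kernel_pairing_le_l1 l u phi g G :
  antiderivative_chain 0 (1 / 2) phi g G ->
  (forall x y, 0 <= x -> x <= y -> y <= 1 / 2 ->
    l * (y - x) <= phi y - phi x <= u * (y - x)) ->
  `|kernel_pairing phi g G (1 / 2) - kernel_pairing phi g G 0|
    <= (u - l) / 4 * (5 / 96 * Num.sqrt 6 - 29 / 432 * r3).
Proof.
move=> ch lip; have [n0 n1 n2 n3] := kernel_nodes_order.
have /andP[c0 cM] := kernel_max_ge.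
have w0 : 0 <= w ^+ 2 / 2 by rewrite divr_ge0// sqr_ge0.
have n3' : 0 <= m + w by rewrite (le_trans n0)// (le_trans n1).
have n1' : m <= 1 / 2 := le_trans n2 n3.
have n0' : m - w <= 1 / 2 := le_trans n1 n1'.
have m0 : 0 <= m := le_trans n0 n1.
have := @kernel_pairing_bounds l u 1 0 0 (m - w) _ _ _ ch lip (lexx 0) n0 n0'.
rewrite kernel_at0 kernel_root_left mulr0 (mul1r c) !addr0.
move=> /(_ c0 (lexx 0) (or_intror n1)) B1.
have := @kernel_pairing_bounds l u (-1) 0 (m - w) m _ _ _ ch lip n0 n1 n1'.
rewrite kernel_root_left kernel_at_vertex !mulN1r !mul0r !addr0 oppr0 opprK.
move=> /(_ (lexx 0) w0 (or_intror (lexx m))) B2.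
have := @kernel_pairing_bounds l u (-1) 0 m (m + w) _ _ _ ch lip m0 n2 n3.
rewrite kernel_root_right kernel_at_vertex !mulN1r !mul0r !addr0 oppr0 opprK.
move=> /(_ w0 (lexx 0) (or_introl (lexx m))) B3.
have := @kernel_pairing_bounds l u 1 0 (m + w) (1 / 2) _ _ _ ch lip n3' n3 (lexx _).
rewrite kernel_root_right kernel_at_half mulr0 (mul1r M) !addr0.
move=> /(_ (lexx 0) (le_trans c0 cM) (or_introl n2)) B4.
have -> : (u - l) / 4 * (5 / 96 * Num.sqrt 6 - 29 / 432 * r3) =
    (u - l) * (kernel_prim (m - w) - kernel_prim (m + w)).
  by rewrite kernel_prim_radius; field.
move: B1 B2 B3 B4; rewrite kernel_prim0 kernel_prim_half.
move: (kernel_prim (m - w)) (kernel_prim m) (kernel_prim (m + w)) => p1 p2 p3.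
move: (kernel_pairing phi g G) => e.
move: (e 0) (e (m - w)) (e m) (e (m + w)) (e (1 / 2)) => e0 e1 e2 e3 e4.
clear => /andP[? ?] /andP[? ?] /andP[? ?] /andP[? ?].
by rewrite ler_norml; apply/andP; split; lra.
Qed.

(** Apply the comparison to [kernel_max - kernel] and [kernel_max + kernel], both
    nonnegative with integral [kernel_max / 2] on [0, 1/2]. *)
Lemma kernel_pairing_le_max l u phi g G :
  antiderivative_chain 0 (1 / 2) phi g G ->
  (forall x y, 0 <= x -> x <= y -> y <= 1 / 2 ->
    l * (y - x) <= phi y - phi x <= u * (y - x)) ->
  let D := kernel_pairing phi g G (1 / 2) - kernel_pairing phi g G 0 in
  let S := phi (1 / 2) - phi 0 in
  `|D| <= M * (S - l / 2) /\ `|D| <= M * (u / 2 - S).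
Proof.
move=> ch lip D S; have [n0 n1 n2 n3] := kernel_nodes_order.
have /andP[c0 cM] := kernel_max_ge; have wM := kernel_radius_le_max.
have w0 : 0 <= w ^+ 2 / 2 by rewrite divr_ge0// sqr_ge0.
have n1' : m <= 1 / 2 := le_trans n2 n3.
have m0 : 0 <= m := le_trans n0 n1.
have M0 : 0 <= M := le_trans c0 cM.
have halves s : 0 <= s * c + M -> 0 <= s * - (w ^+ 2 / 2) + M -> 0 <= s * M + M ->
    l * (M / 2) <= s * D + M * S <= u * (M / 2).
  move=> s1 s2 s3.
  have := @kernel_pairing_bounds l u s M 0 m _ _ _ ch lip (lexx _) m0 n1'.
  rewrite kernel_at0 kernel_at_vertex => /(_ s1 s2 (or_intror (lexx m))).
  have := @kernel_pairing_bounds l u s M m (1 / 2) _ _ _ ch lip m0 n1' (lexx _).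
  rewrite kernel_at_half kernel_at_vertex => /(_ s2 s3 (or_introl (lexx m))).
  rewrite kernel_prim0 kernel_prim_half /D /S.
  move: (kernel_prim m) (kernel_pairing phi g G) => p e.
  move: (e 0) (e m) (e (1 / 2)) (phi 0) (phi m) (phi (1 / 2)) M m.
  clear => e0 e1 e2 f0 f1 f2 M m /andP[? ?] /andP[? ?].
  by apply/andP; split; lra.
have := halves 1; have := halves (-1).
move: D S M c (w ^+ 2 / 2) w0 c0 cM wM M0 {halves}; clear.
move=> D S M c v v0 c0 cM vM M0 h1 h2.
have /andP[h11 h12] : l * (M / 2) <= -1 * D + M * S <= u * (M / 2).
  by apply: h1; lra.
have /andP[h21 h22] : l * (M / 2) <= 1 * D + M * S <= u * (M / 2).
  by apply: h2; lra.
by split; rewrite ler_norml; apply/andP; split; lra.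
Qed.

End kernel.

(** * The quadrature error *)

Lemma within_continuous_reflect {R : realType} (h : R -> R) :
  {within `[0, 1], continuous h} -> {within `[0, 1], continuous (fun t => h (1 - t))}.
Proof.
move=> /subspace_continuousP ch; apply/subspace_continuousP => x x01.
have r01 t : (`[0, 1]%classic : set R) t -> (`[0, 1]%classic : set R) (1 - t).
  by rewrite /= !in_itv/= => /andP[? ?]; apply/andP; split; lra.
apply: (@cvg_comp _ _ _ (fun t => 1 - t) h _ (within `[0, 1] (nbhs (1 - x)))).
  move=> U hU.
  have cr : {for x, continuous (fun t : R => 1 - t)}.
    by apply: cvgB; [exact: cvg_cst|exact: cvg_id].
  apply: (@filterS _ (nbhs x) _ _ _ _ (cr _ hU)) => t /= hr /r01; exact: hr.
exact: ch (r01 _ x01).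
Qed.

(** The kernel on [0, 1] is symmetric about 1/2, so [f] may be replaced by
    [t |-> f t + f (1 - t)] on [0, 1/2].  Then [phi] and [G] vanish at 1/2, and the
    boundary terms of the pairing are the nodes, the integral and the correction. *)
Lemma quadrature_error_kernel_pairing {R : realType} (f df : R -> R) :
  (forall x : R, x \in `]0, 1[%R -> is_derive x (1:R) f (df x)) ->
  {within `[0, 1], continuous f} ->
  let phi t := df t - df (1 - t) in
  let g t := f t + f (1 - t) in
  let F x := (\int[lebesgue_measure]_(t in `[0, x]) f t)%R in
  let G t := F t - F (1 - t) in
  antiderivative_chain 0 (1 / 2) phi g G /\
  kernel_pairing phi g G (1 / 2) - kernel_pairing phi g G 0
    = Q01 f - 1 / 96 * (4 - 3 * Num.sqrt 2) * (df 1 - df 0).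
Proof.
move=> dF0 cf phi g F G.
have intf : lebesgue_measure.-integrable (`[0, 1]%classic : set R) (EFin \o f).
  by apply: continuous_compact_integrable => //; exact: segment_compact.
have cF : {within `[0, 1], continuous F}.
  exact: parameterized_integral_continuous ler01 intf.
have dF (x : R) : x \in `]0, 1[%R -> is_derive x (1:R) F (f x).
  move=> x01; have /andP[x0 x1] : 0 < x < 1 by move: x01; rewrite in_itv.
  have cfx := within_continuous_continuous ltr01 cf x01.
  have [Fx FE] := continuous_FTC1_closed x1 intf x0 cfx.
  by rewrite -FE derive1E; exact: derivableP.
have half (x : R) : x \in `]0, (1 / 2)[%R -> x \in `]0, 1[%R /\ 1 - x \in `]0, 1[%R.
  by rewrite !in_itv/= => /andP[? ?]; split; apply/andP; split; lra.
have dr (x : R) (h dh : R -> R) : is_derive (1 - x) (1:R) h (dh (1 - x)) ->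
    is_derive x (1:R) (fun t => h (1 - t)) (- dh (1 - x)).
  move=> dhx.
  have d1 : is_derive x (1:R) (fun t : R => 1 - t) (- 1).
    by apply: is_derive_eq; rewrite add0r mul1r.
  by have := @is_derive1_comp R h (fun t : R => 1 - t) x _ _ dhx d1;
    rewrite mulrN1.
have sub01 : (`[0, 1 / 2]%classic : set R) `<=` `[0, 1].
  by move=> x /=; rewrite !in_itv/= => /andP[? ?]; apply/andP; split; lra.
split.
  split.
  - move=> x /half[x1 x2]; have d1 := dF0 _ x1; have d2 := dr _ _ df (dF0 _ x2).
    exact: is_deriveD.
  - move=> x /half[x1 x2]; have d1 := dF _ x1; have d2 := dr _ _ f (dF _ x2).
    have -> : g x = f x - - f (1 - x) by rewrite opprK.
    exact: is_deriveB.
  - apply: (continuous_subspaceW sub01) => x.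
    by apply: cvgD; [exact: cf|exact: within_continuous_reflect].
  - apply: (continuous_subspaceW sub01) => x.
    by apply: cvgB; [exact: cF|exact: within_continuous_reflect].
have F0 : F 0 = 0 by rewrite /F set_itv1 Rintegral_set1.
have F1 : F 1 = \int[lebesgue_measure]_(t in unit_itv) f t by [].
have e12 : 1 - 1 / 2 = 1 / 2 :> R by field.
rewrite /kernel_pairing /parts_pairing /phi /g /G e12 subr0 subrr F0 /Q01 -F1.
by rewrite /quad /kernel_cst; field.
Qed.

Theorem theorem12 (R : realType) (f : R -> R) (gamma2 Gamma2 : R) :
  let f' := derive_on unit_itv f in
  let f'' := derive_on unit_itv f' in
  let S1 := f' 1 - f' 0 in
  (forall x, unit_itv x -> derivable_on unit_itv f x) ->
  abs_cont_on 0 1 f' ->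
  lebesgue_measure.-integrable `]0, 1[ (EFin \o f'') ->
  {ae lebesgue_measure, forall t, unit_itv t -> gamma2 <= f'' t <= Gamma2} ->
  [/\ `|Q01 f - P01 f| <=
        (Gamma2 - gamma2) / 2
        * (5 / 96 * Num.sqrt 6 - 29 / 432 * Num.sqrt 3),
      `|Q01 f - P01 f| <= (1 / 12 - Num.sqrt 2 / 32) * (S1 - gamma2)
    & `|Q01 f - P01 f| <= (1 / 12 - Num.sqrt 2 / 32) * (Gamma2 - S1)].
Proof.
move=> f' f'' S1 df acf' _ f''bnd.
have lip := derivative_bounds_of_ac _ _ _ acf' f''bnd.
have df' (x : R) : x \in `]0, 1[ -> is_derive x (1:R) f (f' x).
  move=> x01; apply: derivable_on_is_derive => //; apply: df.
  exact: subset_itv_oo_cc x01.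
have [ch err] := quadrature_error_kernel_pairing f f' df'
  (derivable_on_within_continuous f df).
move: ch err; set phi := (fun t => f' t - f' (1 - t)).
set g := (fun t => f t + f (1 - t)); set G := (fun t => _ - _) => ch err.
(* Folding adds the slopes at t and 1 - t, hence the factors 2. *)
have phi_lip x y : 0 <= x -> x <= y -> y <= 1 / 2 ->
    2 * gamma2 * (y - x) <= phi y - phi x <= 2 * Gamma2 * (y - x).
  move=> x0 xy yh.
  have /andP[l1 u1] : gamma2 * (y - x) <= f' y - f' x <= Gamma2 * (y - x).
    by apply: lip; lra.
  have /andP[l2 u2] : gamma2 * ((1 - x) - (1 - y)) <= f' (1 - x) - f' (1 - y)
      <= Gamma2 * ((1 - x) - (1 - y)) by apply: lip; lra.
  by rewrite /phi; apply/andP; split; lra.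
have e12 : 1 - 1 / 2 = 1 / 2 :> R by field.
have S1E : phi (1 / 2) - phi 0 = S1.
  by rewrite /phi e12 subr0 /S1; ring.
have := kernel_pairing_le_l1 _ _ _ _ _ ch phi_lip.
have := kernel_pairing_le_max _ _ _ _ _ ch phi_lip.
rewrite /= S1E err -/(P01 f) => -[b2 b3] b1; split.
- by have -> : (Gamma2 - gamma2) / 2 = (2 * Gamma2 - 2 * gamma2) / 4 by field.
- by have -> : S1 - gamma2 = S1 - 2 * gamma2 / 2 by field.
- by have -> : Gamma2 - S1 = 2 * Gamma2 / 2 - S1 by field.
Qed.
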